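(* Let $r\ge2$. The multivariate SDP fidelity $F_{\mathrm{SDP}}$ satisfies the following properties for all quantum states $\rho_1,\ldots,\rho_r$ on a common space. (i) (Reduction to classical) If $\rho_1,\ldots,\rho_r$ commute pairwise, then $F_{\mathrm{SDP}}(\rho_1,\ldots,\rho_r)=\frac{2}{r(r-1)}\sum_{i<j}\sum_x\sqrt{\rho_i(x)\rho_j(x)}$, where $(\rho_i(x))_x$ are the eigenvalues of $\rho_i$ in a common eigenbasis. (ii) (Data processing) For every quantum channel $\mathcal N$, $F_{\mathrm{SDP}}(\rho_1,\ldots,\rho_r)\le F_{\mathrm{SDP}}(\mathcal N(\rho_1),\ldots,\mathcal N(\rho_r))$. (iii) (Symmetry) For every permutation $\pi$ of $\{1,\dots,r\}$, $F_{\mathrm{SDP}}(\rho_1,\ldots,\rho_r)=F_{\mathrm{SDP}}(\rho_{\pi(1)},\ldots,\rho_{\pi(r)})$. (iv) (Faithfulness) $F_{\mathrm{SDP}}(\rho_1,\ldots,\rho_r)=1$ if and only if $\rho_i=\rho_j$ for all $i,j$. (v) (Orthogonality) $F_{\mathrm{SDP}}(\rho_1,\ldots,\rho_r)=0$ if and only if $\rho_i\rho_j=0$ for all $i\ne j$. (vi) (Direct-sum property) For every finite alphabet $\mathcal X$, probability distribution $(p(x))_{x\in\mathcal X}$ and states $(\rho_i^x)_{x\in\mathcal X}$, $i=1,\dots,r$, $$F_{\mathrm{SDP}}\Big(\sum_{x}p(x)|x\rangle\langle x|\otimes\rho_1^x,\ldots,\sum_{x}p(x)|x\rangle\langle x|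\otimes\rho_r^x\Big)=\sum_{x}p(x)F_{\mathrm{SDP}}(\rho_1^x,\ldots,\rho_r^x).$$
   Context: All Hilbert spaces are finite-dimensional and complex. A quantum state is a positive semi-definite operator of unit trace; a quantum channel is a completely positive trace-preserving linear map (input and output dimensions may differ). The multivariate SDP fidelity is $$F_{\mathrm{SDP}}(\rho_1,\ldots,\rho_r)=\frac{1}{r(r-1)}\inf_{Y_1,\ldots,Y_r\ge0}\Big\{\sum_{i=1}^r\operatorname{Tr}[Y_i\rho_i]:\ \sum_{i=1}^r|i\rangle\langle i|\otimes Y_i\ \ge\ \sum_{i\ne j}|i\rangle\langle j|\otimes I\Big\},$$ where $\{|i\rangle\}_{i=1}^r$ is the standard basis of $\mathbb C^r$, $Y_i$ act on the space of the states, $I$ is the identity there, and $\ge$ is the Loewner order. $\{|x\rangle\}_{x\in\mathcal X}$ is an orthonormal basis of $\mathbb C^{|\mathcal X|}$. *)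

(* Defs.v *)
From HB Require Import structures.
From mathcomp Require Import all_boot all_order all_algebra all_fingroup.
From mathcomp Require Import classical_sets reals.
From mathcomp Require Import complex mxtens.

Set Implicit Arguments.
Unset Strict Implicit.
Unset Printing Implicit Defensive.

Import Order.TTheory GRing.Theory Num.Theory.
Local Open Scope ring_scope.
Local Open Scope complex_scope.
Local Open Scope sesquilinear_scope.
Local Open Scope classical_set_scope.

(* On [R[i]] the order relation [0 <= z] means that z is real and nonnegative,
   so this condition already forces A to be Hermitian. *)
Definition psdmx (R : realType) (n : nat) (A : 'M[R[i]]_n) : Prop :=
  forall v : 'cV[R[i]]_n, 0 <= (v ^t* *m A *m v) 0 0.

Definition loewner_le (R : realType) (n : nat) (A B : 'M[R[i]]_n) : Prop :=
  psdmx (B - A).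

Definition quantum_state (R : realType) (n : nat) (rho : 'M[R[i]]_n) : Prop :=
  psdmx rho /\ \tr rho = 1.

(* The operator (<i| (x) I) A (|j> (x) I). *)
Definition tens_block (R : realType) (k n : nat) (A : 'M[R[i]]_(k * n))
    (i j : 'I_k) : 'M[R[i]]_n :=
  \matrix_(a, b) A (mxtens_index (i, a)) (mxtens_index (j, b)).

(* The map id_k (x) N. *)
Definition ampliation (R : realType) (k n m : nat)
    (N : 'M[R[i]]_n -> 'M[R[i]]_m) (A : 'M[R[i]]_(k * n)) : 'M[R[i]]_(k * m) :=
  \sum_(i < k) \sum_(j < k) (delta_mx i j *t N (tens_block A i j)).

Definition completely_positive (R : realType) (n m : nat)
    (N : 'M[R[i]]_n -> 'M[R[i]]_m) : Prop :=
  forall (k : nat) (A : 'M[R[i]]_(k * n)), psdmx A -> psdmx (ampliation N A).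

Definition trace_preserving (R : realType) (n m : nat)
    (N : 'M[R[i]]_n -> 'M[R[i]]_m) : Prop :=
  forall A : 'M[R[i]]_n, \tr (N A) = \tr A.

Definition quantum_channel (R : realType) (n m : nat)
    (N : {linear 'M[R[i]]_n -> 'M[R[i]]_m}) : Prop :=
  completely_positive N /\ trace_preserving N.

Definition sdp_feasible (R : realType) (r n : nat) (Y : 'I_r -> 'M[R[i]]_n) :
    Prop :=
  (forall i, psdmx (Y i)) /\
  loewner_le (\sum_(i < r) \sum_(j < r | i != j) (delta_mx i j *t 1%:M))
             (\sum_(i < r) (delta_mx i i *t Y i)).

(* For positive semidefinite rho_i and Y_i the traces are real, so [Re] only
   serves to land in [R]. The set is nonempty (take Y_i = (r - 1) I), and for
   states it is bounded below by 0, so [inf] is a genuine infimum. *)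
Definition F_SDP (R : realType) (r n : nat) (rho : 'I_r -> 'M[R[i]]_n) : R :=
  (r%:R * (r%:R - 1))^-1 *
  inf [set complex.Re (\sum_(i < r) \tr (Y i *m rho i)) |
        Y in [set Y : 'I_r -> 'M[R[i]]_n | sdp_feasible Y]].

(* In both uses of this predicate T has exactly n elements, so that an
   orthonormal family is an orthonormal basis. *)
Definition orthonormal_family (R : realType) (T : finType) (n : nat)
    (e : T -> 'cV[R[i]]_n) : Prop :=
  forall x y, (e x) ^t* *m e y = (x == y)%:R%:M.

Definition common_eigenbasis (R : realType) (r n : nat)
    (rho : 'I_r -> 'M[R[i]]_n) (e : 'I_n -> 'cV[R[i]]_n)
    (lam : 'I_r -> 'I_n -> R) : Prop :=
  orthonormal_family e /\
  forall i x, rho i *m e x = (lam i x)%:C *: e x.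

Definition probability_distribution (R : realType) (X : finType) (p : X -> R) :
    Prop :=
  (forall x, 0 <= p x) /\ \sum_x p x = 1.

(* The operator sum_x p(x) |x><x| (x) sigma^x, with |x> given by e. *)
Definition cq_operator (R : realType) (X : finType) (n : nat)
    (e : X -> 'cV[R[i]]_#|X|) (p : X -> R) (sigma : X -> 'M[R[i]]_n) :
    'M[R[i]]_(#|X| * n) :=
  \sum_x (p x)%:C *: ((e x *m (e x) ^t*) *t sigma x).

(* Main.v *)
Require Import Defs.
From HB Require Import structures.
From mathcomp Require Import all_boot all_order all_algebra all_fingroup.
From mathcomp Require Import classical_sets reals.
From mathcomp Require Import complex mxtens.
From mathcomp Require boolp.
From mathcomp Require Import zify ring lra.

(* Testing the block-matrix constraint on vectors, Y is feasible iff every Y_i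
   is psd and sum_(i != j) <v_i, v_j> <= sum_i <v_i, Y_i v_i> for all families
   (v_i). Two estimates on the infimum then yield all six properties.
   Lower bound: if rho_i = sum_x w_i^x (w_i^x)^* for every i, feeding the
   vectors (w_i^x)_i to the constraint and summing over x bounds the value from
   below by sum_(i != j) sum_x <w_i^x, w_j^x>.
   Upper bound: for an orthonormal basis (e_x), the operators
   Y_i = sum_x (sum_(j != i) s_j(x) / s_i(x)) e_x e_x^* are feasible for all
   weights s > 0, and s_i(x) close to sqrt p_i(x), p_i(x) = <e_x, rho_i e_x>,
   bounds the infimum by the sum over i != j of the classical overlaps
   sum_x sqrt (p_i(x) p_j(x)).
   In a common eigenbasis the two bounds agree. Data processing holds because
   the dual of a channel preserves feasibility, and the direct-sum property
   because feasible points can be compressed to, and assembled from, the blocks. *)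

Set Implicit Arguments.
Unset Strict Implicit.
Unset Printing Implicit Defensive.

Import Order.TTheory GRing.Theory Num.Theory.
Local Open Scope ring_scope.
Local Open Scope sesquilinear_scope.

(** * Adjoints, inner products and sesquilinear forms *)

Section Adjoint.
Variable C : numClosedFieldType.

Lemma adjmxM m n p (A : 'M[C]_(m, n)) (B : 'M[C]_(n, p)) :
  (A *m B)^t* = B^t* *m A^t*.
Proof. by rewrite trmx_mul map_mxM. Qed.

Lemma adjmxD m n (A B : 'M[C]_(m, n)) : (A + B)^t* = A^t* + B^t*.
Proof. by rewrite linearD /= map_mxD. Qed.

Lemma adjmxN m n (A : 'M[C]_(m, n)) : (- A)^t* = - A^t*.
Proof. by rewrite linearN /= map_mxN. Qed.

Lemma adjmxZ m n (c : C) (A : 'M[C]_(m, n)) : (c *: A)^t* = c^* *: A^t*.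
Proof. by rewrite linearZ /= map_mxZ. Qed.

Lemma adjmxE m n (A : 'M[C]_(m, n)) i j : A^t* i j = (A j i)^*.
Proof. by rewrite !mxE. Qed.

Definition dot n (u v : 'cV[C]_n) : C := (u^t* *m v) 0 0.
Definition qform n (A : 'M[C]_n) (u v : 'cV[C]_n) : C := (u^t* *m A *m v) 0 0.

Lemma qformE n (A : 'M[C]_n) u v : qform A u v = dot u (A *m v).
Proof. by rewrite /qform /dot mulmxA. Qed.

Lemma qform1 n (u v : 'cV[C]_n) : qform 1%:M u v = dot u v.
Proof. by rewrite /qform mulmx1. Qed.

Lemma dotE n (u v : 'cV[C]_n) : dot u v = \sum_i (u i 0)^* * v i 0.
Proof. by rewrite /dot mxE; apply: eq_bigr => i _; rewrite adjmxE. Qed.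

Lemma qform_sumE n (A : 'M[C]_n) u v :
  qform A u v = \sum_i \sum_j (u i 0)^* * A i j * v j 0.
Proof.
rewrite /qform -mulmxA mxE; apply: eq_bigr => i _.
by rewrite adjmxE mxE mulr_sumr; apply: eq_bigr => j _; rewrite mulrA.
Qed.

Lemma dotC n (u v : 'cV[C]_n) : dot v u = (dot u v)^*.
Proof. by rewrite /dot -adjmxE adjmxM trmxCK. Qed.

Lemma dot_ge0 n (u : 'cV[C]_n) : 0 <= dot u u.
Proof. by rewrite dotE sumr_ge0 // => i _; rewrite mulrC mul_conjC_ge0. Qed.

Lemma dotDl n (u v w : 'cV[C]_n) : dot (u + v) w = dot u w + dot v w.
Proof. by rewrite /dot adjmxD mulmxDl mxE. Qed.

Lemma dotDr n (u v w : 'cV[C]_n) : dot w (u + v) = dot w u + dot w v.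
Proof. by rewrite /dot mulmxDr mxE. Qed.

Lemma dotZl n c (u v : 'cV[C]_n) : dot (c *: u) v = c^* * dot u v.
Proof. by rewrite /dot adjmxZ -scalemxAl mxE. Qed.

Lemma dotZr n c (u v : 'cV[C]_n) : dot u (c *: v) = c * dot u v.
Proof. by rewrite /dot -scalemxAr mxE. Qed.

Lemma dot0l n (u : 'cV[C]_n) : dot 0 u = 0.
Proof. by rewrite -(scale0r 0) dotZl conjC0 mul0r. Qed.

Lemma dot0r n (u : 'cV[C]_n) : dot u 0 = 0.
Proof. by rewrite -(scale0r 0) dotZr mul0r. Qed.

Lemma qformDm n (A B : 'M[C]_n) u v : qform (A + B) u v = qform A u v + qform B u v.
Proof. by rewrite /qform mulmxDr mulmxDl mxE. Qed.

Lemma qformZm n c (A : 'M[C]_n) u v : qform (c *: A) u v = c * qform A u v.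
Proof. by rewrite /qform -scalemxAr -scalemxAl mxE. Qed.

Lemma qformNm n (A : 'M[C]_n) u v : qform (- A) u v = - qform A u v.
Proof. by rewrite -scaleN1r qformZm mulN1r. Qed.

Lemma qform_summ n (I : finType) (P : pred I) (A : I -> 'M[C]_n) u v :
  qform (\sum_(i | P i) A i) u v = \sum_(i | P i) qform (A i) u v.
Proof. by rewrite /qform mulmx_sumr mulmx_suml summxE. Qed.

Lemma qform_adj n (A : 'M[C]_n) u v : qform (A^t* ) u v = (qform A v u)^*.
Proof. by rewrite /qform -adjmxE !adjmxM !trmxCK mulmxA. Qed.

Lemma qformMadj m n (A : 'M[C]_n) (V : 'M[C]_(m, n)) u v :
  qform (V *m A *m V^t*) u v = qform A (V^t* *m u) (V^t* *m v).
Proof. by rewrite /qform adjmxM trmxCK !mulmxA. Qed.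

Lemma qform_outer n (a b u v : 'cV[C]_n) :
  qform (a *m b^t*) u v = dot u a * dot b v.
Proof.
rewrite /qform mulmxA -[_ *m b^t* *m v]mulmxA (mx11_scalar (b^t* *m v)).
by rewrite mul_mx_scalar mxE mulrC.
Qed.

Lemma tr_outer n (A : 'M[C]_n) (u v : 'cV[C]_n) :
  \tr (A *m (u *m v^t*)) = qform A v u.
Proof. by rewrite mulmxA mxtrace_mulC mulmxA trace_mx11. Qed.

Lemma trace_outer n (u v : 'cV[C]_n) : \tr (u *m v^t*) = dot v u.
Proof. by rewrite mxtrace_mulC trace_mx11. Qed.

End Adjoint.

Local Open Scope complex_scope.

(** * Positive semidefinite matrices and orthonormal bases *)

Section Psd.
Variable R : realType.
Local Notation C := R[i].

(** Complex polarization: a psd form takes real values, so the form of [B = A^* - A] vanishes on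
    every vector. Testing on [e_i + z e_j] with [z = 1] gives [B j i = - B i j], and [z = i] then
    gives [2 i B i j = 0]. *)
Lemma psd_adj n (A : 'M[C]_n) : psdmx A -> A^t* = A.
Proof.
move=> psdA; apply/eqP; rewrite -subr_eq0; apply/eqP; set B := _ - _.
have B0 v : qform B v v = 0.
  rewrite qformDm qformNm qform_adj; apply/eqP; rewrite subr_eq0; apply/eqP.
  by apply/CrealP/ger0_real/psdA.
have BE i j : B i j = qform B (delta_mx i 0) (delta_mx j 0).
  rewrite /qform trmx_delta map_delta_mx -rowE.
  by rewrite -colE !mxE.
have Bz i j (z : C) : z * B i j + (z^*)%R * B j i = 0.
  have := B0 (delta_mx i 0 + z *: delta_mx j 0).
  rewrite qformE mulmxDr -scalemxAr !(dotDl, dotDr, dotZl, dotZr) -!qformE.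
  by rewrite -!BE [B i i]BE [B j j]BE !B0 mulr0 mulr0 addr0 add0r => <-; rewrite ?addr0.
apply/matrixP => i j; rewrite [RHS]mxE.
have := Bz i j 1; have := Bz i j 'i%C.
rewrite conjC1 !mul1r => h1 h2.
have {}h2 : B j i = - B i j by apply/eqP; rewrite -addr_eq0 addrC h2.
move: h1; rewrite complexiE conjCi h2 mulNr mulrN opprK -mulr2n => /eqP.
by rewrite mulrn_eq0 /= mulf_eq0 (negPf (neq0Ci _)) => /eqP.
Qed.

Lemma onb_complete (T : finType) n (e : T -> 'cV[C]_n) :
  #|T| = n -> orthonormal_family e -> \sum_x e x *m (e x)^t* = 1%:M.
Proof.
move=> Tn; case: _ / Tn in e *; move=> onb.
pose E : 'M[C]_#|T| := \matrix_(a, k) e (enum_val k) a 0.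
have colE k : col k E = e (enum_val k).
  by apply/matrixP => a b; rewrite !mxE ord1.
(* [E] is square because [#|T| = n], so its left inverse is also a right inverse. *)
have /mulmx1C <- : E^t* *m E = 1%:M.
  apply/matrixP => k l.
  transitivity (dot (col k E) (col l E)).
    by rewrite dotE mxE; apply: eq_bigr => a _; rewrite !mxE.
  by rewrite !colE /dot onb !mxE (inj_eq enum_val_inj) eqxx.
apply/matrixP => a b; rewrite summxE mxE.
rewrite (reindex (@enum_val T predT)) /=; last exact/onW_bij/enum_val_bij.
apply: eq_bigr => k _; rewrite mxE big_ord1 !mxE //.
Qed.

Lemma unitarymx_onb n (P : 'M[C]_n) :
  P \is unitarymx -> orthonormal_family (fun k => col k (P^t* )).
Proof.
move=> /unitarymxP PP x y; apply/matrixP => a b; rewrite !ord1.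
have := congr1 (fun M : 'M_n => M x y) PP; rewrite !mxE eqxx mulr1n => <-.
by apply: eq_bigr => k _; rewrite !mxE conjCK.
Qed.

Lemma hermitian_spectral_family n (A : 'M[C]_n) : A^t* = A ->
  exists (e : 'I_n -> 'cV[C]_n) (h : 'I_n -> C),
    orthonormal_family e /\ A = \sum_x h x *: (e x *m (e x)^t*).
Proof.
move=> Ah; have /orthomx_spectralP : A \is normalmx by apply/normalmxP; rewrite Ah.
set P := spectralmx A; set d := spectral_diag A.
have Pu : P \is unitarymx by exact: spectral_unitarymx.
rewrite invmx_unitary // => AE.
exists (fun k => col k (P^t* )), (fun k => d 0 k); split; first exact: unitarymx_onb.
rewrite {1}AE; apply/matrixP => a b; rewrite summxE -mulmxA mxE; apply: eq_bigr => k _.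
rewrite mul_diag_mx !mxE big_ord1 !mxE conjCK mulrCA //.
Qed.

(** Eigenvectors scaled by the square roots of their eigenvalues; the eigenvalue at [e x] is the
    value of the form there, hence nonnegative. Such rank-one decompositions feed the lower bound
    and the analysis of channels. *)
Lemma psd_vectors n (A : 'M[C]_n) : psdmx A ->
  exists w : 'I_n -> 'cV[C]_n, A = \sum_k w k *m (w k)^t*.
Proof.
move=> psdA; have [e [h [onb AE]]] := hermitian_spectral_family (psd_adj psdA).
have h_ge0 x : 0 <= h x.
  have := psdA (e x); rewrite -/(qform _ _ _) AE qform_summ (bigD1 x) //=.
  rewrite big1 ?addr0 => [|y /negPf yx].
    by rewrite qformZm qform_outer /dot onb eqxx !mxE !mulr1.
  by rewrite qformZm qform_outer /dot onb eq_sym yx !mxE /= !mul0rn mul0r mulr0.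
exists (fun x => sqrtC (h x) *: e x); rewrite {1}AE; apply: eq_bigr => x _.
rewrite adjmxZ -scalemxAl -scalemxAr scalerA.
by rewrite -normCK ger0_norm ?sqrtC_ge0 // sqrtCK.
Qed.

Lemma psd_sum n (I : finType) (A : I -> 'M[C]_n) :
  (forall i, psdmx (A i)) -> psdmx (\sum_i A i).
Proof.
by move=> h v; rewrite -/(qform _ _ _) qform_summ sumr_ge0 // => i _; apply: h.
Qed.

Lemma psdZ n (c : C) (A : 'M[C]_n) : 0 <= c -> psdmx A -> psdmx (c *: A).
Proof. by move=> c0 h v; rewrite -/(qform _ _ _) qformZm mulr_ge0 //; apply: h. Qed.

Lemma psd_outer n (u : 'cV[C]_n) : psdmx (u *m u^t*).
Proof.
move=> v; rewrite -/(qform _ _ _) qform_outer [dot v u]dotC.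
by rewrite mulrC mul_conjC_ge0.
Qed.

Lemma psd_congr m n (V : 'M[C]_(m, n)) (A : 'M[C]_n) :
  psdmx A -> psdmx (V *m A *m V^t*).
Proof. by move=> h v; rewrite -/(qform _ _ _) qformMadj; apply: h. Qed.

Lemma tr_psdM_ge0 n (A B : 'M[C]_n) : psdmx A -> psdmx B -> 0 <= \tr (A *m B).
Proof.
move=> pA /psd_vectors[w ->]; rewrite mulmx_sumr linear_sum /=.
by apply: sumr_ge0 => k _; rewrite tr_outer; apply: pA.
Qed.

End Psd.

(** * Block structure of matrices and vectors on a tensor product *)

Section Blocks.
Variables (R : realType) (k n : nat).
Local Notation C := R[i].

(** Together with [stackv], this identifies a vector of the tensor product with a [k]-tuple of
    vectors of length [n]. *)
Definition blockv (v : 'cV[C]_(k * n)) (i : 'I_k) : 'cV[C]_n :=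
  \col_a v (mxtens_index (i, a)) 0.

Definition stackv (w : 'I_k -> 'cV[C]_n) : 'cV[C]_(k * n) :=
  \col_I w (mxtens_unindex I).1 (mxtens_unindex I).2 0.

Lemma stackvK w i : blockv (stackv w) i = w i.
Proof. by apply/matrixP => a b; rewrite ord1 !mxE mxtens_indexK. Qed.

Lemma sum_tens (F : 'I_(k * n) -> C) :
  \sum_I F I = \sum_i \sum_a F (mxtens_index (i, a)).
Proof.
rewrite pair_big /= (reindex (@mxtens_index k n)) /=.
  by apply: eq_bigr => -[i a].
by exists (@mxtens_unindex k n) => x _; rewrite (mxtens_indexK, mxtens_unindexK).
Qed.

Lemma qform_block (A : 'M[C]_(k * n)) u v :
  qform A u v =
  \sum_i \sum_j qform (tens_block A i j) (blockv u i) (blockv v j).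
Proof.
rewrite qform_sumE sum_tens; apply: eq_bigr => i _.
under eq_bigr => a _ do rewrite sum_tens.
rewrite exchange_big /=; apply: eq_bigr => j _.
rewrite qform_sumE; apply: eq_bigr => a _; apply: eq_bigr => b _.
by rewrite !mxE.
Qed.

Lemma tens_block_outer (u v : 'cV[C]_(k * n)) i j :
  tens_block (u *m v^t*) i j = blockv u i *m (blockv v j)^t*.
Proof. by apply/matrixP => a b; rewrite !mxE !big_ord1 !mxE. Qed.

Lemma tens_block_sum (I : finType) (A : I -> 'M[C]_(k * n)) i j :
  tens_block (\sum_x A x) i j = \sum_x tens_block (A x) i j.
Proof.
apply/matrixP => a b; rewrite !mxE !summxE; apply: eq_bigr => x _.
by rewrite !mxE.
Qed.

Lemma tens_blockB (A B : 'M[C]_(k * n)) i j :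
  tens_block (A - B) i j = tens_block A i j - tens_block B i j.
Proof. by apply/matrixP => a b; rewrite !mxE. Qed.

Lemma tens_block_diag (Y : 'I_k -> 'M[C]_n) i j :
  tens_block (\sum_l (delta_mx l l *t Y l)) i j = (i == j)%:R *: Y i.
Proof.
apply/matrixP => a b; rewrite !mxE summxE (bigD1 i) //= big1 ?addr0.
  by rewrite tensmxE mxE eqxx /= eq_sym.
by move=> l /negPf li; rewrite tensmxE mxE eq_sym li mul0r.
Qed.

(** The relation [P] is arbitrary so that the same computation serves the off-diagonal sum of the
    SDP constraint and the full double sum in [ampliation]. *)
Lemma tens_block_pairs (P : rel 'I_k) (Z : 'I_k -> 'I_k -> 'M[C]_n) i j :
  tens_block (\sum_l \sum_(l' | P l l') (delta_mx l l' *t Z l l')) i j =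
  (P i j)%:R *: Z i j.
Proof.
apply/matrixP => a b; rewrite !mxE summxE (bigD1 i) //= [X in _ + X]big1 ?addr0.
  rewrite summxE big_mkcond (bigD1 j) //= [X in _ + X]big1 ?addr0.
    by case: (P i j); rewrite ?mul0r // tensmxE mxE !eqxx.
  move=> l /negPf lj; case: ifP => // _.
  by rewrite tensmxE mxE [j == l]eq_sym lj andbF mul0r.
move=> l /negPf li; rewrite summxE big1 // => l' _.
by rewrite tensmxE mxE [i == l]eq_sym li mul0r.
Qed.

End Blocks.

(** * Vector form of feasibility and the lower bound *)

Section Feasible.
Variables (R : realType) (r : nat).
Local Notation C := R[i].

Lemma sum_diag_block (G : 'I_r -> 'I_r -> C) i :
  \sum_j (i == j)%:R * G i j = G i i.
Proof.
rewrite (bigD1 i) //= eqxx mul1r big1 ?addr0 // => j /negPf.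
by rewrite eq_sym => ->; rewrite mul0r.
Qed.

Lemma sdp_feasibleP n (Y : 'I_r -> 'M[C]_n) :
  sdp_feasible Y <-> (forall i, psdmx (Y i)) /\
    forall v : 'I_r -> 'cV[C]_n,
      \sum_i \sum_(j | i != j) dot (v i) (v j) <= \sum_i qform (Y i) (v i) (v i).
Proof.
(* Any [w] that agrees with the blocks of [v] is allowed, so both directions can use the identity:
   one with [stackv v], the other with [blockv v]. *)
have key (v : 'cV[C]_(r * n)) w :
    (forall i, blockv v i = w i) ->
    qform (\sum_i (delta_mx i i *t Y i) -
      \sum_i \sum_(j | i != j) (delta_mx i j *t 1%:M)) v v =
    \sum_i qform (Y i) (w i) (w i) - \sum_i \sum_(j | i != j) dot (w i) (w j).
  move=> vw; rewrite qform_block -[RHS]sumrB; apply: eq_bigr => i _.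
  under eq_bigr => j _.
    rewrite tens_blockB tens_block_diag (@tens_block_pairs R r n (fun i j => i != j)).
    rewrite qformDm qformNm !qformZm qform1 !vw.
    over.
  rewrite /= sumrB (sum_diag_block (fun i j => qform (Y i) (w i) (w j))).
  congr (_ - _); rewrite [RHS]big_mkcond; apply: eq_bigr => j _.
  by case: eqP; rewrite (mul0r, mul1r).
split=> -[pY fY]; split=> // v.
  have := fY (stackv v).
  by rewrite -/(qform _ _ _) (key _ v) ?subr_ge0 // => i; apply: stackvK.
by rewrite -/(qform _ _ _) (key _ (blockv v)) // subr_ge0; apply: fY.
Qed.

(** The objective before [Re] is taken: an inequality in [R[i]] also records that the difference of
    its two sides is real. *)
Definition sdp_value n (Y rho : 'I_r -> 'M[C]_n) : C := \sum_i \tr (Y i *m rho i).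

Lemma sdp_value_ge n (T : finType) (Y rho : 'I_r -> 'M[C]_n)
    (w : 'I_r -> T -> 'cV[C]_n) :
  sdp_feasible Y -> (forall i, rho i = \sum_x w i x *m (w i x)^t*) ->
  \sum_i \sum_(j | i != j) \sum_x dot (w i x) (w j x) <= sdp_value Y rho.
Proof.
move=> /sdp_feasibleP[_ fY] rhoE.
have -> : sdp_value Y rho = \sum_x \sum_i qform (Y i) (w i x) (w i x).
  rewrite exchange_big; apply: eq_bigr => i _.
  rewrite rhoE mulmx_sumr linear_sum; apply: eq_bigr => x _; exact: tr_outer.
under eq_bigr => i _ do rewrite exchange_big.
rewrite exchange_big /=; apply: ler_sum => x _; exact: fY.
Qed.

Lemma sdp_value_ge0 n (Y rho : 'I_r -> 'M[C]_n) :
  sdp_feasible Y -> (forall i, psdmx (rho i)) -> 0 <= sdp_value Y rho.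
Proof. by move=> [pY _] prho; apply: sumr_ge0 => i _; apply: tr_psdM_ge0. Qed.

(** The infimum without the factor [1 / (r (r - 1))], which is restored in the final theorem. *)
Definition sdp_inf n (rho : 'I_r -> 'M[C]_n) : R :=
  inf [set complex.Re (sdp_value Y rho) |
        Y in [set Y : 'I_r -> 'M[C]_n | sdp_feasible Y]]%classic.

Lemma F_SDPE n (rho : 'I_r -> 'M[C]_n) :
  F_SDP rho = (r%:R * (r%:R - 1))^-1 * sdp_inf rho.
Proof. by []. Qed.

Lemma le_Re (x y : C) : x <= y -> complex.Re x <= complex.Re y.
Proof. by rewrite lecE => /andP[]. Qed.

Lemma sdp_inf_le n (Y rho : 'I_r -> 'M[C]_n) :
  (forall i, psdmx (rho i)) -> sdp_feasible Y ->
  sdp_inf rho <= complex.Re (sdp_value Y rho).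
Proof.
move=> prho fY; apply: ge_inf; last by exists Y.
by exists 0 => _ [Z fZ <-]; apply: (@le_Re 0); apply: sdp_value_ge0.
Qed.

End Feasible.

(** * Diagonal feasible points and the upper bound *)

Section UpperBound.
Variables (R : realType) (r : nat).
Local Notation C := R[i].

Lemma sum_pairsC (V : nmodType) (G : 'I_r -> 'I_r -> V) :
  \sum_i \sum_(j | i != j) G i j = \sum_i \sum_(j | i != j) G j i.
Proof.
under eq_bigr do rewrite big_mkcond.
rewrite exchange_big /=; apply: eq_bigr => i _; rewrite [RHS]big_mkcond.
by apply: eq_bigr => j _; rewrite eq_sym.
Qed.

(** Once doubled and symmetrized in [i] and [j], the difference of the two sides is the sum over
    [i != j] of [s_i s_j |v_i / s_i - v_j / s_j|^2]. *)
Lemma weighted_pairs_le n (s : 'I_r -> C) (v : 'I_r -> 'cV[C]_n) :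
  (forall i, 0 < s i) ->
  \sum_i \sum_(j | i != j) dot (v i) (v j) <=
  \sum_i \sum_(j | i != j) s j / s i * dot (v i) (v i).
Proof.
move=> s_gt0; rewrite -(ler_pM2l (ltr0n _ 2)) !mulr_natl mulr2n.
rewrite [X in X + _]sum_pairsC -subr_ge0 mulr2n [X in X + _ - _]sum_pairsC.
rewrite -!big_split /= -sumrB; apply: sumr_ge0 => i _.
rewrite -!big_split /= -sumrB; apply: sumr_ge0 => j _.
have sJ k : ((s k)^*)%R = s k by apply/CrealP/gtr0_real.
have s0 k : s k != 0 by rewrite gt_eqF.
have := dot_ge0 ((s i)^-1 *: v i + (- (s j)^-1) *: v j).
rewrite -(pmulr_rge0 _ (mulr_gt0 (s_gt0 i) (s_gt0 j))).
rewrite !(dotDl, dotDr, dotZl, dotZr) !rmorphN /= !fmorphV /= !sJ.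
congr (0 <= _); field; by rewrite !s0.
Qed.

Definition diag_sdp n (e : 'I_n -> 'cV[C]_n) (s : 'I_r -> 'I_n -> R) (i : 'I_r) :
    'M[C]_n :=
  \sum_x (\sum_(j | i != j) (s j x)%:C / (s i x)%:C) *: (e x *m (e x)^t*).

(** Parseval's identity, written with the projections onto the lines of the [e x], so that each term
    is again an inner product of vectors to which [weighted_pairs_le] applies. *)
Lemma dot_onb n (e : 'I_n -> 'cV[C]_n) (u v : 'cV[C]_n) :
  orthonormal_family e ->
  dot u v = \sum_x dot (dot (e x) u *: e x) (dot (e x) v *: e x).
Proof.
move=> onb; rewrite -qform1 -(onb_complete (card_ord n) onb) qform_summ.
apply: eq_bigr => x _; rewrite qform_outer dotZl dotZr [X in _ * (_ * X)]/dot onb.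
by rewrite eqxx mxE !mulr1 (dotC (e x) u).
Qed.

Lemma diag_sdp_feasible n (e : 'I_n -> 'cV[C]_n) (s : 'I_r -> 'I_n -> R) :
  orthonormal_family e -> (forall i x, 0 < s i x) -> sdp_feasible (diag_sdp e s).
Proof.
move=> onb s_gt0; have sC i x : 0 < (s i x)%:C by rewrite ltcR.
apply/sdp_feasibleP; split=> [i|v].
  apply: psd_sum => x; apply: psdZ; last exact: psd_outer.
  by apply: sumr_ge0 => j _; rewrite divr_ge0 ?ltW.
pose c x i := dot (e x) (v i) *: e x.
have -> : \sum_i \sum_(j | i != j) dot (v i) (v j) =
    \sum_x \sum_i \sum_(j | i != j) dot (c x i) (c x j).
  rewrite exchange_big; apply: eq_bigr => i _.
  by rewrite exchange_big; apply: eq_bigr => j _; rewrite (dot_onb _ _ onb).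
have -> : \sum_i qform (diag_sdp e s i) (v i) (v i) =
    \sum_x \sum_i \sum_(j | i != j) (s j x)%:C / (s i x)%:C * dot (c x i) (c x i).
  rewrite exchange_big; apply: eq_bigr => i _.
  rewrite qform_summ; apply: eq_bigr => x _.
  rewrite qformZm qform_outer mulr_suml; apply: eq_bigr => j _; congr (_ * _).
  by rewrite dotZl dotZr [X in _ * (_ * X)]/dot onb eqxx mxE mulr1 (dotC (e x) (v i)).
by apply: ler_sum => x _; apply: (@weighted_pairs_le _ (fun i => (s i x)%:C)).
Qed.

(** The outcome probabilities when a state [A] is measured in the basis [e]. *)
Definition diag_prob n (e : 'I_n -> 'cV[C]_n) (A : 'M[C]_n) (x : 'I_n) : R :=
  complex.Re (qform A (e x) (e x)).

Lemma diag_probE n (e : 'I_n -> 'cV[C]_n) (A : 'M[C]_n) x :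
  psdmx A -> qform A (e x) (e x) = (diag_prob e A x)%:C.
Proof. by move=> pA; rewrite /diag_prob RRe_real // ger0_real //; apply: pA. Qed.

Lemma diag_prob_ge0 n (e : 'I_n -> 'cV[C]_n) (A : 'M[C]_n) x :
  psdmx A -> 0 <= diag_prob e A x.
Proof. by move=> pA; apply: (@le_Re _ 0); apply: pA. Qed.

Lemma sum_diag_prob n (e : 'I_n -> 'cV[C]_n) (A : 'M[C]_n) :
  orthonormal_family e -> psdmx A -> \tr A = (\sum_x diag_prob e A x)%:C.
Proof.
move=> onb pA; rewrite -[A in LHS]mulmx1 -(onb_complete (card_ord n) onb).
rewrite mulmx_sumr linear_sum rmorph_sum; apply: eq_bigr => x _.
by rewrite /= tr_outer (diag_probE _ _ pA).
Qed.

Lemma sdp_inf_le_weights n (rho : 'I_r -> 'M[C]_n) (e : 'I_n -> 'cV[C]_n)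
    (s : 'I_r -> 'I_n -> R) :
  (forall i, psdmx (rho i)) -> orthonormal_family e ->
  (forall i x, 0 < s i x) ->
  sdp_inf rho <=
    \sum_i \sum_(j | i != j) \sum_x s j x / s i x * diag_prob e (rho i) x.
Proof.
move=> prho onb s_gt0; have fY := diag_sdp_feasible onb s_gt0.
rewrite (le_trans (sdp_inf_le prho fY)) //.
rewrite -lecR RRe_real; last by rewrite ger0_real // sdp_value_ge0.
rewrite le_eqVlt; apply/orP; left; apply/eqP.
rewrite /sdp_value rmorph_sum; apply: eq_bigr => i _; rewrite rmorph_sum /=.
rewrite mxtrace_mulC /diag_sdp mulmx_sumr linear_sum /=.
under [RHS]eq_bigr do rewrite rmorph_sum.
rewrite [RHS]exchange_big; apply: eq_bigr => x _.
rewrite -scalemxAr linearZ /= tr_outer mulr_suml; apply: eq_bigr => j _.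
by rewrite (diag_probE _ _ (prho i)) !rmorphM fmorphV.
Qed.

Lemma ler_addeps1 (x y K : R) :
  (forall eps, 0 < eps -> eps <= 1 -> x <= y + eps * K) -> x <= y.
Proof.
move=> h; rewrite leNgt; apply/negP => yx.
have K0 : 0 < K.
  have := h 1 ltr01 (lexx _); rewrite mul1r => ?; lra.
(* With this choice [eps * K] is at most half the gap [x - y], which contradicts the hypothesis. *)
pose eps := Num.min 1 ((x - y) / (2 * K)).
have e0 : 0 < eps by rewrite lt_min ltr01 divr_gt0 ?mulr_gt0 // subr_gt0.
have := h eps e0; rewrite ge_min lexx => /(_ isT).
have : eps * K <= (x - y) / (2 * K) * K by rewrite ler_pM2r // ge_min lexx orbT.
have -> : (x - y) / (2 * K) * K = (x - y) / 2 by field; rewrite gt_eqF.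
lra.
Qed.

(* The dual weights s_i = sqrt p_i would be optimal; eps > 0 keeps them invertible. *)
Lemma sdp_inf_le_sqrt n (rho : 'I_r -> 'M[C]_n) (e : 'I_n -> 'cV[C]_n) :
  (forall i, psdmx (rho i)) -> orthonormal_family e ->
  sdp_inf rho <= \sum_i \sum_(j | i != j) \sum_x
    Num.sqrt (diag_prob e (rho i) x) * Num.sqrt (diag_prob e (rho j) x).
Proof.
move=> prho onb; pose a i x := Num.sqrt (diag_prob e (rho i) x).
have a0 i x : 0 <= a i x by exact: sqrtr_ge0.
(* The error constant comes from [p^2 (q + eps) / (p + eps) <= (p + eps) (q + eps) <= p q + eps (p +
   q + 1)] with [p = a i x] and [q = a j x]; the last inequality uses [eps <= 1]. *)
apply: (@ler_addeps1 _ _ (\sum_i \sum_(j | i != j) \sum_x (a i x + a j x + 1))).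
move=> eps e0 e1.
have s0 i x : 0 < a i x + eps by rewrite ltr_wpDl.
rewrite (le_trans (sdp_inf_le_weights prho onb s0)) //.
rewrite mulr_sumr -big_split; apply: ler_sum => i _ /=.
rewrite mulr_sumr -big_split; apply: ler_sum => j _ /=.
rewrite mulr_sumr -big_split; apply: ler_sum => x _ /=.
have pE : diag_prob e (rho i) x = a i x ^+ 2 by rewrite sqr_sqrtr // diag_prob_ge0.
rewrite -!/(a _ _) {1}pE mulrAC ler_pdivrMr //.
have := a0 i x; have := a0 j x; move: (a i x) (a j x) => p q q0 p0.
have e_ge0 := ltW e0.
apply: (@le_trans _ _ ((p + eps) * (q + eps) * (p + eps))).
  rewrite mulrAC [leRHS]mulrC ler_wpM2l ?addr_ge0 // -expr2.
  by rewrite lerXn2r ?nnegrE ?addr_ge0 // lerDl.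
apply: ler_wpM2r; first exact: addr_ge0.
have -> : (p + eps) * (q + eps) = p * q + eps * (p + q + eps) by ring.
by rewrite lerD2l ler_wpM2l // lerD2l.
Qed.

Lemma std_onb n : orthonormal_family (fun x : 'I_n => delta_mx x 0 : 'cV[C]_n).
Proof.
move=> x y; apply/matrixP => a b; rewrite !ord1.
by rewrite trmx_delta map_delta_mx mul_delta_mx_cond mulmxnE !mxE !eqxx !mulr1n.
Qed.

Lemma sdp_feasible_nonempty n : exists Y : 'I_r -> 'M[C]_n, sdp_feasible Y.
Proof.
(* All weights are 1, which gives [Y_i = (r - 1) I]. *)
exists (diag_sdp (fun x => delta_mx x 0) (fun _ _ => 1)).
by apply: diag_sdp_feasible => //; apply: std_onb.
Qed.

Lemma sdp_inf_ge n (rho : 'I_r -> 'M[C]_n) (x : R) :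
  (forall Y, sdp_feasible Y -> x <= complex.Re (sdp_value Y rho)) ->
  x <= sdp_inf rho.
Proof.
move=> h; apply: lb_le_inf; last by move=> _ [Y fY <-]; apply: h.
by have [Y fY] := sdp_feasible_nonempty n; exists (complex.Re (sdp_value Y rho)), Y.
Qed.

Lemma sdp_inf_adherent n (rho : 'I_r -> 'M[C]_n) (eps : R) :
  0 < eps -> (forall i, psdmx (rho i)) ->
  exists Y, sdp_feasible Y /\ complex.Re (sdp_value Y rho) < sdp_inf rho + eps.
Proof.
move=> e0 prho.
have [|_ [Y fY <-] lt] := @inf_adherent R [set complex.Re (sdp_value Y rho) |
        Y in [set Y : 'I_r -> 'M[C]_n | sdp_feasible Y]]%classic _ e0.
  split.
    by have [Y fY] := sdp_feasible_nonempty n; exists (complex.Re (sdp_value Y rho)), Y.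
  by exists 0 => _ [Z fZ <-]; apply: (@le_Re _ 0); apply: sdp_value_ge0.
by exists Y.
Qed.

End UpperBound.

(** * Commuting states and the classical formula *)

Section Properties.
Variables (R : realType) (r : nat).
Local Notation C := R[i].

Lemma sum_pairs_lt (G : 'I_r -> 'I_r -> R) : (forall i j, G i j = G j i) ->
  \sum_i \sum_(j | i != j) G i j = 2 * \sum_(i < r) \sum_(j < r | (i < j)%N) G i j.
Proof.
move=> Gsym; rewrite mulr_natl mulr2n.
have -> : \sum_i \sum_(j | i != j) G i j =
    \sum_(i < r) (\sum_(j < r | (i < j)%N) G i j + \sum_(j < r | (j < i)%N) G i j).
  apply: eq_bigr => i _; rewrite (bigID (fun j : 'I_r => (i < j)%N)) /=.
  by congr (_ + _); apply: eq_bigl => j; rewrite -val_eqE /=; lia.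
rewrite big_split; congr (_ + _).
rewrite (exchange_big_dep xpredT) //=; apply: eq_bigr => i _.
by apply: eq_bigr => j _; rewrite Gsym.
Qed.

Lemma sum_pairs1 : \sum_(i < r) \sum_(j < r | i != j) 1 = r%:R * (r%:R - 1) :> R.
Proof.
transitivity (\sum_(i < r) (r%:R - 1 : R)); last first.
  by rewrite sumr_const card_ord mulr_natl.
apply: eq_bigr => i _; apply/eqP; rewrite eq_sym subr_eq eq_sym; apply/eqP.
transitivity (\sum_(j < r) (1 : R)).
  rewrite [RHS](bigD1 i) //= addrC; congr (_ + _).
  by apply: eq_bigl => j; rewrite eq_sym.
by rewrite sumr_const card_ord.
Qed.

Lemma eigenbasis_spectral n (rho : 'I_r -> 'M[C]_n) e lam i :
  common_eigenbasis rho e lam ->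
  rho i = \sum_x (lam i x)%:C *: (e x *m (e x)^t*).
Proof.
move=> [onb eig]; rewrite -{1}[rho i]mulmx1 -(onb_complete (card_ord n) onb).
rewrite mulmx_sumr; apply: eq_bigr => x _.
by rewrite mulmxA eig scalemxAl.
Qed.

Lemma eigenbasis_diag_prob n (rho : 'I_r -> 'M[C]_n) e lam i x :
  common_eigenbasis rho e lam -> diag_prob e (rho i) x = lam i x.
Proof.
move=> [onb eig]; rewrite /diag_prob qformE eig dotZr /dot onb eqxx mxE mulr1 //.
Qed.

Lemma conjCR (x : R) : ((x%:C)^*)%R = x%:C.
Proof. exact: conjc_real. Qed.

Lemma sdp_inf_eigenbasis n (rho : 'I_r -> 'M[C]_n) e lam :
  (forall i, psdmx (rho i)) -> common_eigenbasis rho e lam ->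
  sdp_inf rho = 2 * \sum_(i < r) \sum_(j < r | (i < j)%N)
                      \sum_(x < n) Num.sqrt (lam i x * lam j x).
Proof.
move=> prho eb; have [onb _] := eb.
have lam0 i x : 0 <= lam i x.
  by rewrite -(eigenbasis_diag_prob i x eb) diag_prob_ge0.
rewrite -sum_pairs_lt => [|i j]; last first.
  by apply: eq_bigr => x _; rewrite mulrC.
apply/eqP; rewrite eq_le; apply/andP; split.
  rewrite (le_trans (sdp_inf_le_sqrt prho onb)) // le_eqVlt; apply/orP; left; apply/eqP.
  apply: eq_bigr => i _; apply: eq_bigr => j _; apply: eq_bigr => x _.
  by rewrite !(eigenbasis_diag_prob _ _ eb) sqrtrM.
apply: sdp_inf_ge => Y fY.
(* With these vectors [<w i x, w j x>] is the classical overlap term [sqrt (lam i x * lam j x)], so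
   the lower bound meets the upper bound. *)
pose w i x := (Num.sqrt (lam i x))%:C *: e x.
have wE i : rho i = \sum_x w i x *m (w i x)^t*.
  rewrite (eigenbasis_spectral i eb); apply: eq_bigr => x _.
  rewrite /w adjmxZ -scalemxAl -scalemxAr scalerA conjCR -rmorphM /=.
  by rewrite -expr2 sqr_sqrtr.
have := sdp_value_ge fY wE; set S := (X in X <= _); set T := (X in _ -> X <= _).
suff -> : S = T%:C by move/le_Re.
rewrite /S /T rmorph_sum; apply: eq_bigr => i _; rewrite rmorph_sum.
apply: eq_bigr => j _; rewrite rmorph_sum; apply: eq_bigr => x _ /=.
by rewrite dotZl dotZr /dot onb eqxx mxE mulr1 conjCR -rmorphM sqrtrM.
Qed.

(** A commuting family is triangularized by one unitary; the resulting triangular matrices are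
    Hermitian, hence diagonal. *)
Lemma commuting_eigenbasis n (rho : 'I_r -> 'M[C]_n) :
  (forall i, psdmx (rho i)) -> (forall i j, rho i *m rho j = rho j *m rho i) ->
  exists (e : 'I_n -> 'cV[C]_n) (lam : 'I_r -> 'I_n -> R),
    common_eigenbasis rho e lam.
Proof.
move=> prho com.
have [_ _ /mapP[i _ ->] /mapP[j _ ->] | P Pu /allP trigP] :=
  @cotrigonalization C n [seq rho i | i <- enum 'I_r]; first exact: com.
pose e k := col k (P^t* ).
have onb : orthonormal_family e by exact: unitarymx_onb.
exists e, (fun i => diag_prob e (rho i)); split=> // i x.
have : similar_trig P (rho i) by apply: trigP; rewrite map_f // mem_enum.
rewrite /similar_to conjymx //.
set D := P *m rho i *m P^t* => /is_trig_mxP trigD.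
have Dadj : D^t* = D by rewrite /D !adjmxM trmxCK psd_adj // mulmxA.
have DE k l : D k l = qform (rho i) (e k) (e l).
  rewrite /D /qform !mxE; apply: eq_bigr => a _; rewrite !mxE; congr (_ * _).
  by apply: eq_bigr => b _; rewrite !mxE conjCK.
have D0 k l : k != l -> D k l = 0.
  rewrite -val_eqE /= neq_ltn => /orP[/trigD//|lk].
  by rewrite -Dadj adjmxE (trigD _ _ lk) conjC0.
rewrite -[_ *m e x]mul1mx -(onb_complete (card_ord n) onb) mulmx_suml (bigD1 x) //=.
rewrite big1 => [|y yx]; rewrite -mulmxA.
  rewrite addr0 [X in e x *m X]mx11_scalar mul_mx_scalar mulmxA -/(qform _ _ _).
  by rewrite -diag_probE.
rewrite [X in e y *m X]mx11_scalar mul_mx_scalar mulmxA -/(qform _ _ _) -DE.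
by rewrite D0 // scale0r.
Qed.

End Properties.

(** * Invariance under permutations *)

Section Symmetry.
Variables (R : realType) (r : nat).
Local Notation C := R[i].

(** The constraint treats all indices alike, so relabelling by the inverse of [s] keeps [Y]
    feasible. As [rho'] is given only through a pointwise equation, the reverse inequality is the
    same statement for the inverse permutation. *)
Lemma sdp_inf_perm_le n (rho rho' : 'I_r -> 'M[C]_n) (s : {perm 'I_r}) :
  (forall i, psdmx (rho i)) -> (forall i, rho' i = rho (s i)) ->
  sdp_inf rho <= sdp_inf rho'.
Proof.
move=> prho rhoE; apply: sdp_inf_ge => Y fY.
have [pY {}fY] := (sdp_feasibleP Y).1 fY.
pose Z i := Y (s^-1%g i).
have fZ : sdp_feasible Z.
  apply/sdp_feasibleP; split=> [i|v]; first exact: pY.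
  rewrite (reindex_inj (@perm_inj _ s)) [leRHS](reindex_inj (@perm_inj _ s)) /=.
  under [leRHS]eq_bigr => i _ do rewrite /Z permK.
  apply: le_trans (fY (fun i => v (s i))); rewrite le_eqVlt; apply/orP; left; apply/eqP.
  apply: eq_bigr => i _; rewrite (reindex_inj (@perm_inj _ s)).
  by apply: eq_bigl => j; rewrite (inj_eq perm_inj).
have -> : sdp_value Y rho' = sdp_value Z rho.
  rewrite /sdp_value [RHS](reindex_inj (@perm_inj _ s)).
  by apply: eq_bigr => i _; rewrite /Z permK rhoE.
exact: sdp_inf_le.
Qed.

Lemma sdp_inf_perm n (rho : 'I_r -> 'M[C]_n) (s : {perm 'I_r}) :
  (forall i, psdmx (rho i)) -> sdp_inf rho = sdp_inf (fun i => rho (s i)).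
Proof.
move=> prho; apply/eqP; rewrite eq_le (@sdp_inf_perm_le _ _ _ s) //=.
by apply: (@sdp_inf_perm_le _ _ _ s^-1%g) => // i; rewrite permKV.
Qed.

End Symmetry.

(** * Dual maps of channels and data processing *)

Section DataProcessing.
Variable R : realType.
Local Notation C := R[i].

(** The Heisenberg-picture adjoint for the pairing [Tr (A B)]. Its indices are swapped because the
    trace of [M *m delta_mx b a] is [M a b]. *)
Definition dual_map n m (N : 'M[C]_n -> 'M[C]_m) (Y : 'M[C]_m) : 'M[C]_n :=
  \matrix_(a, b) \tr (Y *m N (delta_mx b a)).

Lemma tr_dual_map n m (N : {linear 'M[C]_n -> 'M[C]_m}) Y A :
  \tr (dual_map N Y *m A) = \tr (Y *m N A).
Proof.
rewrite {2}[A]matrix_sum_delta linear_sum mulmx_sumr linear_sum.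
transitivity (\sum_a \sum_b dual_map N Y a b * A b a).
  by apply: eq_bigr => a _; rewrite mxE.
rewrite exchange_big /=; apply: eq_bigr => b _.
rewrite linear_sum mulmx_sumr linear_sum /=; apply: eq_bigr => a _.
by rewrite linearZ /= -scalemxAr linearZ /= mxE mulrC.
Qed.

Lemma qform_dual_map n m (N : {linear 'M[C]_n -> 'M[C]_m}) Y u v :
  qform (dual_map N Y) v u = \tr (Y *m N (u *m v^t*)).
Proof. by rewrite -tr_outer tr_dual_map. Qed.

Lemma tens_block_ampliation k n m (N : 'M[C]_n -> 'M[C]_m) (A : 'M[C]_(k * n)) i j :
  tens_block (ampliation N A) i j = N (tens_block A i j).
Proof.
have := @tens_block_pairs R k m (fun _ _ => true) (fun i j => N (tens_block A i j)) i j.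
by rewrite scale1r.
Qed.

(** The ampliation maps the rank-one matrix of the stacked vector to a psd matrix. The blocks of a
    rank-one decomposition of that matrix yield a single family [u] valid for all pairs [i], [j] at
    once. *)
Lemma completely_positive_blocks k n m (N : 'M[C]_n -> 'M[C]_m)
    (w : 'I_k -> 'cV[C]_n) :
  completely_positive N ->
  exists u : 'I_k -> 'I_(k * m) -> 'cV[C]_m,
    forall i j, N (w i *m (w j)^t*) = \sum_x u i x *m (u j x)^t*.
Proof.
move=> cpN; have := cpN k _ (psd_outer (stackv w)).
move=> /psd_vectors[u uE]; exists (fun i x => blockv (u x) i) => i j.
rewrite -(stackvK w i) -(stackvK w j) -tens_block_outer -tens_block_ampliation uE.
by rewrite tens_block_sum; apply: eq_bigr => x _; rewrite tens_block_outer.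
Qed.

(** The right-hand side of the constraint at [v] is the objective of [Y] at the images of the
    [v_i v_i^*] under [N]. Since these images decompose along the [u i x], [sdp_value_ge] bounds it
    below, and trace preservation turns the sum over [x] of [<u i x, u j x>] back into
    [<v_i, v_j>]. *)
Lemma dual_map_feasible r n m (N : {linear 'M[C]_n -> 'M[C]_m})
    (Y : 'I_r -> 'M[C]_m) :
  quantum_channel N -> sdp_feasible Y -> sdp_feasible (fun i => dual_map N (Y i)).
Proof.
move=> [cpN tpN] fY; have [pY _] := fY.
apply/sdp_feasibleP; split=> [i v|v].
  rewrite -/(qform _ _ _) qform_dual_map.
  (* The constant family is enough here: a diagonal block shows that [N] maps [v v^*] to a psd
     matrix. *)
  have [u uE] := completely_positive_blocks (fun _ : 'I_r => v) cpN.
  by rewrite (uE i i); apply: tr_psdM_ge0 => //; apply: psd_sum => x; exact: psd_outer.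
have [u uE] := completely_positive_blocks v cpN.
have := sdp_value_ge fY (fun i => uE i i).
rewrite /sdp_value; under [X in _ -> is_true (_ <= X)]eq_bigr do rewrite qform_dual_map.
apply: le_trans; rewrite le_eqVlt; apply/orP; left; apply/eqP.
apply: eq_bigr => i _; apply: eq_bigr => j _.
rewrite -trace_outer -tpN uE linear_sum /=; apply: eq_bigr => x _.
by rewrite trace_outer.
Qed.

Lemma sdp_inf_channel r n m (N : {linear 'M[C]_n -> 'M[C]_m})
    (rho : 'I_r -> 'M[C]_n) :
  (forall i, psdmx (rho i)) -> quantum_channel N ->
  sdp_inf rho <= sdp_inf (fun i => N (rho i)).
Proof.
move=> prho chN; apply: sdp_inf_ge => Y /(dual_map_feasible chN) fY.
rewrite (le_trans (sdp_inf_le prho fY)) // /sdp_value.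
by under eq_bigr do rewrite tr_dual_map.
Qed.

End DataProcessing.

(** * Faithfulness: the maximal value of the infimum *)

Section Faithfulness.
Variables (R : realType) (r : nat).
Local Notation C := R[i].

(** The Bhattacharyya coefficient of two distributions is 1 minus their squared Hellinger distance;
    expanding the square and using total mass 1 gives it. *)
Lemma sum_sqrt_diag_prob n (e : 'I_n -> 'cV[C]_n) (A B : 'M[C]_n) :
  orthonormal_family e -> quantum_state A -> quantum_state B ->
  \sum_x Num.sqrt (diag_prob e A x) * Num.sqrt (diag_prob e B x) =
  1 - (\sum_x (Num.sqrt (diag_prob e A x) - Num.sqrt (diag_prob e B x)) ^+ 2) / 2.
Proof.
move=> onb [pA tA] [pB tB].
have sA : \sum_x diag_prob e A x = 1 by apply: (@complexI R); rewrite -sum_diag_prob.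
have sB : \sum_x diag_prob e B x = 1 by apply: (@complexI R); rewrite -sum_diag_prob.
have one : 1 = (\sum_x diag_prob e A x + \sum_x diag_prob e B x) / 2 :> R.
  by rewrite sA sB; field.
rewrite [X in _ = X - _]one.
rewrite -mulrBl -big_split -sumrB mulr_suml; apply: eq_bigr => x _ /=.
have := sqr_sqrtr (diag_prob_ge0 e x pA); have := sqr_sqrtr (diag_prob_ge0 e x pB).
by move: (Num.sqrt (diag_prob e A x)) (Num.sqrt (diag_prob e B x)) => a b <- <-; field.
Qed.

Lemma sum_sqrt_diag_prob_le1 n (e : 'I_n -> 'cV[C]_n) (A B : 'M[C]_n) :
  orthonormal_family e -> quantum_state A -> quantum_state B ->
  \sum_x Num.sqrt (diag_prob e A x) * Num.sqrt (diag_prob e B x) <= 1.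
Proof.
move=> onb sA sB; rewrite sum_sqrt_diag_prob // gerBl divr_ge0 // sumr_ge0 // => x _.
exact: sqr_ge0.
Qed.

Lemma sdp_inf_le_max n (rho : 'I_r -> 'M[C]_n) :
  (forall i, quantum_state (rho i)) -> sdp_inf rho <= r%:R * (r%:R - 1).
Proof.
move=> st; have prho i : psdmx (rho i) by case: (st i).
rewrite (le_trans (sdp_inf_le_sqrt prho (@std_onb R n))) // -sum_pairs1.
apply: ler_sum => i _; apply: ler_sum => j _.
exact: (sum_sqrt_diag_prob_le1 (@std_onb R n)).
Qed.

(** One decomposition of the common state serves every index, so each ordered pair contributes the
    trace of that state, which is 1. *)
Lemma sdp_inf_const n (rho : 'I_r -> 'M[C]_n) :
  (forall i, quantum_state (rho i)) -> (forall i j, rho i = rho j) ->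
  r%:R * (r%:R - 1) <= sdp_inf rho.
Proof.
move=> st eqrho; apply: sdp_inf_ge => Y fY.
suff : (r%:R * (r%:R - 1))%:C <= sdp_value Y rho by move=> /le_Re.
rewrite -sum_pairs1 !rmorph_sum.
case: (posnP r) => [r0|r_gt0].
  rewrite big1 ?sdp_value_ge0 // => [i|i _]; first by case: (st i).
  by exfalso; move: (ltn_ord i); rewrite {2}r0.
have [p1 t1] := st (Ordinal r_gt0); have [w wE] := psd_vectors p1.
have := @sdp_value_ge _ _ _ _ Y rho (fun _ => w) fY.
move=> /(_ (fun i => etrans (eqrho _ _) wE)); apply: le_trans.
rewrite le_eqVlt; apply/orP; left; apply/eqP; apply: eq_bigr => i _.
rewrite rmorph_sum; apply: eq_bigr => j _ /=.
transitivity (\tr (rho (Ordinal r_gt0))); first by rewrite t1.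
by rewrite wE linear_sum; apply: eq_bigr => x _; rewrite /= trace_outer.
Qed.

(* Measuring in an eigenbasis of the difference of two distinct states separates
   them, which makes one classical overlap strictly less than 1. *)
Lemma sdp_inf_max_eq n (rho : 'I_r -> 'M[C]_n) :
  (forall i, quantum_state (rho i)) -> sdp_inf rho = r%:R * (r%:R - 1) ->
  forall i j, rho i = rho j.
Proof.
move=> st infE i j; have [->//|ij] := eqVneq i j.
have prho k : psdmx (rho k) by case: (st k).
have herm : (rho i - rho j)^t* = rho i - rho j.
  by rewrite adjmxD adjmxN !psd_adj.
have [e [h [onb hE]]] := hermitian_spectral_family herm.
pose B k l := \sum_x Num.sqrt (diag_prob e (rho k) x) * Num.sqrt (diag_prob e (rho l) x).
have B1 k l : 0 <= 1 - B k l by rewrite subr_ge0 sum_sqrt_diag_prob_le1.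
(* The upper bound forces the total deficit to be at most 0; since every deficit is nonnegative,
   each one vanishes. *)
have S0 : \sum_k \sum_(l | k != l) (1 - B k l) = 0.
  apply/eqP; rewrite eq_le andbC sumr_ge0 /=; last by move=> k _; apply: sumr_ge0.
  under eq_bigr do rewrite sumrB.
  by rewrite sumrB sum_pairs1 subr_le0 -infE sdp_inf_le_sqrt.
have /psumr_eq0P/(_ S0)/(_ i isT) Si :
    forall k, true -> 0 <= \sum_(l | k != l) (1 - B k l) by move=> k _; apply: sumr_ge0.
have /psumr_eq0P/(_ Si)/(_ j ij)/eqP :
    forall l, i != l -> 0 <= 1 - B i l by [].
rewrite /B sum_sqrt_diag_prob // opprB addrC subrK mulf_eq0 invr_eq0 pnatr_eq0 orbF.
move=> /eqP sq0; apply/eqP; rewrite -subr_eq0 hE; apply/eqP; apply: big1 => x _.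
have /psumr_eq0P/(_ sq0)/(_ x isT)/eqP :
    forall y, true -> 0 <= (Num.sqrt (diag_prob e (rho i) y) -
      Num.sqrt (diag_prob e (rho j) y)) ^+ 2 by move=> y _; apply: sqr_ge0.
rewrite sqrf_eq0 subr_eq0 eqr_sqrt ?diag_prob_ge0 // => /eqP pij.
(* The eigenvalue [h x] is the difference of the two outcome probabilities at [x], already shown to
   be equal. *)
have <- : qform (rho i - rho j) (e x) (e x) = h x.
  rewrite hE qform_summ (bigD1 x) //= big1 ?addr0 => [|y /negPf yx].
    by rewrite qformZm qform_outer /dot onb eqxx !mxE !mulr1.
  by rewrite qformZm qform_outer /dot onb eq_sym yx !mxE /= !mul0rn mul0r mulr0.
by rewrite qformDm qformNm !(diag_probE _ _ (prho _)) pij subrr scale0r.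
Qed.

End Faithfulness.

(** * Orthogonality: vanishing of the infimum *)

Section Orthogonality.
Variables (R : realType) (r : nat).
Local Notation C := R[i].

Lemma sum_two (V : nmodType) (F : 'I_r -> V) i j : i != j ->
  (forall k, k != i -> k != j -> F k = 0) -> \sum_k F k = F i + F j.
Proof.
move=> ij F0; rewrite (bigD1 i) //= (bigD1 j) /=; last by rewrite eq_sym.
by rewrite big1 ?addr0 // => k /andP[ki kj]; apply: F0.
Qed.

(** A nonzero overlap between rank-one components of two of the operators keeps the objective away
    from 0, uniformly over feasible [Y]. *)
Lemma overlap_le_sdp_value n (Y rho : 'I_r -> 'M[C]_n) (T : finType)
    (u w : T -> 'cV[C]_n) i j a b :
  i != j -> sdp_feasible Y -> (forall k, psdmx (rho k)) ->
  rho i = \sum_x u x *m (u x)^t* -> rho j = \sum_x w x *m (w x)^t* ->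
  2 * `|dot (u a) (w b)| ^+ 2 <=
    (`|dot (u a) (w b)| ^+ 2 + 1) * sdp_value Y rho.
Proof.
move=> ij fY prho uE wE; have [pY {}fY] := (sdp_feasibleP Y).1 fY.
have term_le k (z : T -> 'cV[C]_n) c : rho k = \sum_x z x *m (z x)^t* ->
    qform (Y k) (z c) (z c) <= sdp_value Y rho.
  move=> zE; rewrite /sdp_value (bigD1 k) //= zE mulmx_sumr linear_sum (bigD1 c) //=.
  rewrite tr_outer -addrA lerDl addr_ge0 // sumr_ge0 // => x _.
    by rewrite tr_outer; apply: pY.
  exact: tr_psdM_ge0.
set c := dot (u a) (w b).
(* The factor [c] aligns the phases: both cross terms become [|c|^2], while the right-hand side
   picks up [|c|^2] at [i] and 1 at [j]. *)
pose v k := if k == i then c *: u a else if k == j then w b else 0.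
have vi : v i = c *: u a by rewrite /v eqxx.
have vj : v j = w b by rewrite /v eq_sym (negPf ij) eqxx.
have v0 k : k != i -> k != j -> v k = 0 by rewrite /v => /negPf-> /negPf->.
have := fY v; rewrite (sum_two ij); last first.
  by move=> k ki kj; apply: big1 => l _; rewrite v0 // dot0l.
have inner k l : k != l -> (k \in [:: i; j]) -> (l \in [:: i; j]) ->
    \sum_(m | k != m) dot (v k) (v m) = dot (v k) (v l).
  move=> kl kij lij; rewrite (bigD1 l) //= big1 ?addr0 // => m /andP[km ml].
  rewrite (v0 m) ?dot0r //; move: kij lij kl km ml;
    rewrite !inE => /orP[]/eqP-> /orP[]/eqP->;
    by rewrite ?eqxx // => _ km ml //; rewrite eq_sym.
rewrite (inner i j) ?(inner j i) ?inE ?eqxx ?orbT // 1?eq_sym //.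
rewrite (sum_two ij); last first.
  by move=> k ki kj; rewrite v0 // /qform mulmx0 mxE.
rewrite vi vj dotZl dotZr [dot (w b) _]dotC -/c.
rewrite qformE -scalemxAr dotZl dotZr -qformE [_ * (c * _)]mulrA -!normCKC -normCK.
rewrite -mulr2n -[_ *+ 2]mulr_natl.
move/le_trans; apply; rewrite mulrDl mul1r lerD ?(term_le _ _ _ wE) //.
by rewrite ler_wpM2l ?exprn_ge0 // (term_le _ _ _ uE).
Qed.

Lemma sdp_inf_eq0_orthogonal n (rho : 'I_r -> 'M[C]_n) :
  (forall i, psdmx (rho i)) -> sdp_inf rho = 0 ->
  forall i j, i != j -> rho i *m rho j = 0.
Proof.
move=> prho inf0 i j ij.
have [u uE] := psd_vectors (prho i); have [w wE] := psd_vectors (prho j).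
have uw0 a b : dot (u a) (w b) = 0.
  apply/eqP; rewrite -normr_eq0 -sqrf_eq0 -add_Re2_Im2.
  set t := (X in X%:C); have t0 : 0 <= t by rewrite addr_ge0 ?sqr_ge0.
  move: t0; rewrite le_eqVlt => /orP[/eqP<- //|t_gt0].
  have t1_gt0 : 0 < t + 1 by rewrite addr_gt0.
  (* For [t = |<u a, w b>|^2 > 0], a feasible value below [t / (t + 1)] contradicts the bound
     [2 t <= (t + 1) * value]. *)
  have [Y [fY]] := sdp_inf_adherent (divr_gt0 t_gt0 t1_gt0) prho.
  rewrite inf0 add0r ltr_pdivlMr // mulrC => lt.
  have := overlap_le_sdp_value a b ij fY prho uE wE.
  rewrite -add_Re2_Im2 -/t.
  have -> : sdp_value Y rho = (complex.Re (sdp_value Y rho))%:C.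
    by rewrite RRe_real // ger0_real // sdp_value_ge0.
  move=> /le_Re /=.
  move: lt; set z := complex.Re _; rewrite !(mul0r, subr0, addr0, mulr0) => *.
  lra.
rewrite uE wE mulmx_suml; apply: big1 => a _; rewrite mulmx_sumr; apply: big1 => b _.
rewrite mulmxA -[_ *m _ *m w b]mulmxA [X in u a *m X]mx11_scalar -/(dot _ _) uw0.
by rewrite mul_mx_scalar scale0r mul0mx.
Qed.

(** Operators with vanishing products commute, so the classical formula applies, and in the common
    eigenbasis every product [lam i x * lam j x] with [i != j] is 0. *)
Lemma orthogonal_sdp_inf_eq0 n (rho : 'I_r -> 'M[C]_n) :
  (forall i, psdmx (rho i)) -> (forall i j, i != j -> rho i *m rho j = 0) ->
  sdp_inf rho = 0.
Proof.
move=> prho orth.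
have [|e [lam eb]] := commuting_eigenbasis prho.
  by move=> i j; have [->//|ij] := eqVneq i j; rewrite !orth // eq_sym.
rewrite (sdp_inf_eigenbasis prho eb) big1 ?mulr0 // => i _.
apply: big1 => j ij; apply: big1 => x _; have [onb eig] := eb.
suff : (lam i x * lam j x)%:C = 0 :> C by move=> /complexI->; rewrite sqrtr0.
have {}ij : i != j by rewrite -val_eqE /= neq_ltn ij.
have := congr1 (fun M => dot (e x) (M *m e x)) (orth i j ij).
rewrite -mulmxA eig -scalemxAr eig !dotZr mul0mx dot0r /dot onb eqxx mxE mulr1.
by rewrite rmorphM mulrC.
Qed.

End Orthogonality.

(** * Direct sums along isometries with orthogonal ranges that fill the space *)

Section DirectSum.
Variables (R : realType) (r : nat) (X : finType) (m n : nat).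
Local Notation C := R[i].
Variable V : X -> 'M[C]_(m, n).
Hypothesis V_isometry : forall x y, (V x)^t* *m V y = (x == y)%:R%:M.
Hypothesis V_complete : \sum_x V x *m (V x)^t* = 1%:M.
Variables (p : X -> R) (rho : X -> 'I_r -> 'M[C]_n).
Hypothesis p_ge0 : forall x, 0 <= p x.
Hypothesis psd_rho : forall x i, psdmx (rho x i).

Let direct_sum i := \sum_x (p x)%:C *: (V x *m rho x i *m (V x)^t*).

Lemma psd_direct_sum i : psdmx (direct_sum i).
Proof. by apply: psd_sum => x; apply: psdZ; [rewrite lecR|apply: psd_congr]. Qed.

Lemma sdp_value_direct_sum (Z : 'I_r -> 'M[C]_m) :
  sdp_value Z direct_sum =
  \sum_x (p x)%:C * sdp_value (fun i => (V x)^t* *m Z i *m V x) (rho x).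
Proof.
rewrite /sdp_value; under [RHS]eq_bigr do rewrite mulr_sumr.
rewrite [RHS]exchange_big; apply: eq_bigr => i _.
rewrite mulmx_sumr linear_sum /=; apply: eq_bigr => x _.
rewrite -scalemxAr linearZ /=; congr (_ * _).
by rewrite !mulmxA mxtrace_mulC !mulmxA.
Qed.

Lemma Re_sum_scale (z : X -> C) :
  complex.Re (\sum_x (p x)%:C * z x) = \sum_x p x * complex.Re (z x).
Proof.
have ReD : {morph @complex.Re R : u v / u + v} by move=> [a b] [c d].
rewrite (big_morph _ ReD (erefl : complex.Re 0 = 0)); apply: eq_bigr => x _.
by case: (z x) => a b /=; rewrite mul0r subr0.
Qed.

(** The constraint for [Z] is tested on the vectors [V x *m v i], whose inner products are those of
    the [v i]. *)
Lemma compress_feasible (Z : 'I_r -> 'M[C]_m) x :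
  sdp_feasible Z -> sdp_feasible (fun i => (V x)^t* *m Z i *m V x).
Proof.
move=> /sdp_feasibleP[pZ fZ].
have qE A u v : qform ((V x)^t* *m A *m V x) u v = qform A (V x *m u) (V x *m v).
  by rewrite /qform adjmxM !mulmxA.
apply/sdp_feasibleP; split=> [i v|v]; first by rewrite -/(qform _ _ _) qE; apply: pZ.
under [leRHS]eq_bigr do rewrite qE.
apply: le_trans (fZ (fun i => V x *m v i)); rewrite le_eqVlt; apply/orP; left; apply/eqP.
apply: eq_bigr => i _; apply: eq_bigr => j _.
by rewrite /dot adjmxM mulmxA -[_ *m V x]mulmxA V_isometry eqxx mulmx1.
Qed.

(** Completeness splits [<v i, v j>] into the inner products of the block components, and the
    constraint of [Y x] handles block [x]. *)
Lemma direct_sum_feasible (Y : X -> 'I_r -> 'M[C]_n) :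
  (forall x, sdp_feasible (Y x)) ->
  sdp_feasible (fun i => \sum_x V x *m Y x i *m (V x)^t*).
Proof.
move=> fY; apply/sdp_feasibleP; split=> [i|v].
  by apply: psd_sum => x; apply: psd_congr; have [] := fY x.
have -> : \sum_i \sum_(j | i != j) dot (v i) (v j) =
    \sum_x \sum_i \sum_(j | i != j) dot ((V x)^t* *m v i) ((V x)^t* *m v j).
  rewrite exchange_big; apply: eq_bigr => i _; rewrite exchange_big.
  apply: eq_bigr => j _; rewrite -qform1 -V_complete qform_summ.
  by apply: eq_bigr => x _; rewrite /qform /dot adjmxM trmxCK !mulmxA.
under [leRHS]eq_bigr do rewrite qform_summ.
rewrite [leRHS]exchange_big; apply: ler_sum => x _.
under [leRHS]eq_bigr do rewrite qformMadj.
exact: ((sdp_feasibleP _).1 (fY x)).2.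
Qed.

Lemma sdp_inf_direct_sum : \sum_x p x = 1 ->
  sdp_inf direct_sum = \sum_x p x * sdp_inf (rho x).
Proof.
move=> p1; apply/eqP; rewrite eq_le; apply/andP; split.
  apply/ler_addgt0Pr => eps eps0.
  (* A point within [eps] of the optimum is chosen in each block; the weights [p x] sum to 1, so the
     assembled point loses only [eps] in total. *)
  have [Y YP] := fin_all_exists (fun x => sdp_inf_adherent eps0 (psd_rho x)).
  have fZ := direct_sum_feasible (fun x => (YP x).1).
  rewrite (le_trans (sdp_inf_le psd_direct_sum fZ)) // sdp_value_direct_sum Re_sum_scale.
  rewrite -[eps]mul1r -p1 mulr_suml -big_split; apply: ler_sum => x _ /=.
  rewrite -mulrDr ler_wpM2l // ltW //; apply: le_lt_trans (YP x).2.
  rewrite le_eqVlt; apply/orP; left; apply/eqP; congr complex.Re.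
  apply: eq_bigr => i _; congr (\tr (_ *m _)).
  (* Compressing the assembled point to block [x] gives back [Y x i], because distinct blocks are
     orthogonal. *)
  rewrite mulmx_sumr mulmx_suml (bigD1 x) //= big1 ?addr0 => [|y yx].
    by rewrite !mulmxA V_isometry eqxx mul1mx -mulmxA V_isometry eqxx mulmx1.
  by rewrite !mulmxA V_isometry eq_sym (negPf yx) /= raddf0 !mul0mx.
apply: sdp_inf_ge => Z fZ; rewrite sdp_value_direct_sum Re_sum_scale.
by apply: ler_sum => x _; rewrite ler_wpM2l // sdp_inf_le //; apply: compress_feasible.
Qed.

End DirectSum.

(** * Classical-quantum operators as direct sums *)

Section ClassicalQuantum.
Variables (R : realType) (X : finType) (n : nat) (e : X -> 'cV[R[i]]_#|X|).
Local Notation C := R[i].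

(** The operator [|x> (x) I], given by its entries so that it has [n] columns rather than
    [1 * n]. *)
Definition ket_isometry x : 'M[C]_(#|X| * n, n) :=
  \matrix_(I, b) (e x (mxtens_unindex I).1 0 * ((mxtens_unindex I).2 == b)%:R).

Lemma ket_isometryE x k a b :
  ket_isometry x (mxtens_index (k, a)) b = e x k 0 * (a == b)%:R.
Proof. by rewrite mxE mxtens_indexK. Qed.

Lemma ket_isometry_conj x (A : 'M[C]_n) :
  ket_isometry x *m A *m (ket_isometry x)^t* = (e x *m (e x)^t*) *t A.
Proof.
apply/matrixP => I J; case: (mxtens_indexP I) => k a; case: (mxtens_indexP J) => l b.
rewrite tensmxE !mxE big_ord1 adjmxE (bigD1 b) //= big1 ?addr0 => [|c /negPf cb].
  rewrite adjmxE ket_isometryE eqxx mulr1 mxE (bigD1 a) //= big1 ?addr0 => [|c /negPf ca].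
    by rewrite ket_isometryE eqxx mulr1 mulrAC.
  by rewrite ket_isometryE eq_sym ca mulr0 mul0r.
by rewrite adjmxE ket_isometryE eq_sym cb mulr0 conjC0 mulr0.
Qed.

Lemma ket_isometry_isometry : orthonormal_family e ->
  forall x y, (ket_isometry x)^t* *m ket_isometry y = (x == y)%:R%:M.
Proof.
move=> onb x y; apply/matrixP => a b.
have <- : dot (e x) (e y) = (x == y)%:R by rewrite /dot onb mxE eqxx mulr1n.
rewrite !mxE sum_tens dotE -mulr_natr mulr_suml; apply: eq_bigr => k _.
rewrite (bigD1 a) //= big1 ?addr0 => [|c /negPf ca].
  by rewrite adjmxE !ket_isometryE eqxx mulr1 mulrA.
by rewrite adjmxE ket_isometryE ca mulr0 conjC0 mul0r.
Qed.

Lemma ket_isometry_complete : orthonormal_family e ->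
  \sum_x ket_isometry x *m (ket_isometry x)^t* = 1%:M.
Proof.
move=> onb; apply/matrixP => I J.
case: (mxtens_indexP I) => k a; case: (mxtens_indexP J) => l b.
have := congr1 (fun M : 'M_ _ => M k l) (onb_complete (erefl _) onb).
rewrite summxE [RHS]mxE => eE; rewrite summxE.
(* An identity factor is inserted so that [ket_isometry_conj] applies with [A = I]; completeness
   then reduces to that of [e]. *)
under eq_bigr do
  rewrite -[ket_isometry _ in X in (X *m _) _ _]mulmx1 ket_isometry_conj tensmxE.
rewrite -mulr_suml eE !mxE -natrM mulnb.
by rewrite (inj_eq (can_inj (@mxtens_indexK _ _))) xpair_eqE.
Qed.

Lemma cq_operator_direct_sum (p : X -> R) (sigma : X -> 'M[C]_n) :
  cq_operator e p sigma =
  \sum_x (p x)%:C *: (ket_isometry x *m sigma x *m (ket_isometry x)^t*).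
Proof. by apply: eq_bigr => x _; rewrite ket_isometry_conj. Qed.

End ClassicalQuantum.

(** * Assembly of the six properties *)

Theorem mainTheorem6 (R : realType) (r : nat) (hr : (2 <= r)%N) (n : nat) :
  (forall rho : 'I_r -> 'M[R[i]]_n, (forall i, quantum_state (rho i)) ->
    (* (i) reduction to classical *)
    ((forall i j, rho i *m rho j = rho j *m rho i) ->
       (exists (e : 'I_n -> 'cV[R[i]]_n) (lam : 'I_r -> 'I_n -> R),
          common_eigenbasis rho e lam) /\
       (forall (e : 'I_n -> 'cV[R[i]]_n) (lam : 'I_r -> 'I_n -> R),
          common_eigenbasis rho e lam ->
          F_SDP rho =
            2 / (r%:R * (r%:R - 1)) *
            \sum_(i < r) \sum_(j < r | (i < j)%N)
              \sum_(x < n) Num.sqrt (lam i x * lam j x))) /\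
    (* (ii) data processing *)
    (forall (m : nat) (N : {linear 'M[R[i]]_n -> 'M[R[i]]_m}),
       quantum_channel N -> F_SDP rho <= F_SDP (fun i => N (rho i))) /\
    (* (iii) symmetry *)
    (forall s : {perm 'I_r}, F_SDP rho = F_SDP (fun i => rho (s i))) /\
    (* (iv) faithfulness *)
    (F_SDP rho = 1 <-> forall i j, rho i = rho j) /\
    (* (v) orthogonality *)
    (F_SDP rho = 0 <-> forall i j, i != j -> rho i *m rho j = 0)) /\
  (* (vi) direct-sum property *)
  (forall (X : finType) (e : X -> 'cV[R[i]]_#|X|) (p : X -> R)
      (rho : X -> 'I_r -> 'M[R[i]]_n),
    orthonormal_family e -> probability_distribution p ->
    (forall x i, quantum_state (rho x i)) ->
    F_SDP (fun i => cq_operator e p (fun x => rho x i)) =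
      \sum_x p x * F_SDP (rho x)).
Proof.
(* Here [2 <= r] enters: the normalizing factor is positive and can be cancelled in (ii), (iv) and
   (v). *)
have rr : 0 < r%:R * (r%:R - 1) :> R.
  by rewrite mulr_gt0 ?subr_gt0 ?ltr0n ?ltr1n // (leq_trans _ hr).
split=> [rho st|X e p rho onb [p0 p1] st].
  have prho i : psdmx (rho i) by case: (st i).
  split.
    move=> com; split; first exact: commuting_eigenbasis.
    move=> e lam eb; rewrite F_SDPE (sdp_inf_eigenbasis prho eb) mulrA.
    by rewrite [_^-1 * 2]mulrC.
  split.
    move=> m N chN; rewrite !F_SDPE ler_pM2l ?invr_gt0 //.
    exact: sdp_inf_channel.
  split; first by move=> s; rewrite !F_SDPE -sdp_inf_perm.
  rewrite F_SDPE; split; split.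
  - move=> F1; apply: sdp_inf_max_eq => //.
    by rewrite -[LHS](mulVKf (lt0r_neq0 rr)) F1 mulr1.
  - move=> eqrho; have -> : sdp_inf rho = r%:R * (r%:R - 1).
      by apply/eqP; rewrite eq_le sdp_inf_le_max // sdp_inf_const.
    by rewrite mulVf // lt0r_neq0.
  - move=> /eqP; rewrite mulf_eq0 invr_eq0 (negPf (lt0r_neq0 rr)) => /eqP.
    exact: sdp_inf_eq0_orthogonal.
  - by move=> orth; rewrite orthogonal_sdp_inf_eq0 ?mulr0.
have prho x i : psdmx (rho x i) by case: (st x i).
have dsE := sdp_inf_direct_sum (ket_isometry_isometry n onb)
  (ket_isometry_complete n onb) p0 prho p1.
under eq_bigr do rewrite F_SDPE mulrCA.
rewrite F_SDPE -mulr_sumr -dsE; congr (_ * sdp_inf _).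
by apply: boolp.funext => i; rewrite cq_operator_direct_sum.
Qed.
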